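(* Let $X$ be a compact metric space, $\alpha:X\to X$ a homeomorphism, $\Gamma=X\times_\alpha\mathbb Z$ the transformation groupoid, $G$ a compact abelian group, and $(E,p,X)$ a locally trivial principal $G$-bundle over $X$ given by a finite open cover $\{U_j\}_{j\in\mathbb J}$ of $X$ and transition functions $c_{i,j}:U_i\cap U_j\to G$. Let $\Lambda=\bigsqcup_{n\in\mathbb Z}\Lambda_n$ be the principal $G$-bundle over $\Gamma$ constructed from this data (see context), with its range and source maps. Then $\Lambda$ is a topological groupoid, and its unit space $\Lambda^{(0)}\subset\Lambda_0$ can be identified with $X\times\{0\}=\Gamma^{(0)}$. If $[(g,x,\vec i,n)]\in\Lambda_n\subset\Lambda$ and $[(g',x',\vec{i'},n')]\in\Lambda_{n'}\subset\Lambda$ satisfy $s([(g,x,\vec i,n)])=r([(g',x',\vec{i'},n')])$, i.e. $\alpha^n(x)=x'$, then the formulas for the groupoid product are given case by case as follows. (a) If $n,n'\ge 0$, then $[(g,x,\vec i,n)]\cdot[(g',x',\vec{i'},n')]=[(gg',x,(\vec i,\vec{i'}),n+n')]$. (b) If $n,n'<0$, then $[(g,x,\vec i,n)]\cdot[(g',\alpha^n(x),\vec{i'},n')]=[(gg',x,(\vec i,\vec{i'}),n+n')]$. (c) If $n>0$ and $n'=-n<0$, then $[(g,x,\vec i,n)]\cdot[(g',\alpha^n(x),\vec{i'},n')]=[(c^{(n)}_{\vec i,\sigma_n(\vec{i'})}(x)\,gg',x,1,0)]$. (d) If $n<0$ and $n'=-n>0$, then $[(g,x,\vec i,n)]\cdot[(g',\alpha^n(x),\vec{i'},n')]=[(c^{(-n)}_{\vec{i'},\sigma_{-n}(\vec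 i)}(\alpha^n(x))\,gg',x,1,0)]$. (e) If $n<0<n'<|n|$ and $\vec i=(\vec{i_1},\vec{i_2})$ with $\vec{i_1}\in\mathbb J^{-n-n'}$ and $\vec{i_2}\in\mathbb J^{n'}$, then $[(g,x,\vec i,n)]\cdot[(g',\alpha^n(x),\vec{i'},n')]=[(c^{(n')}_{\vec{i'},\sigma_{n'}(\vec{i_2})}(\alpha^n(x))\,gg',x,\vec{i_1},n+n')]$. (f) If $n<0<n'$ with $|n|<n'$, and $\vec{i'}=(\vec{i_1'},\vec{i_2'})\in\mathbb J^{n'}$ with $\vec{i_1'}\in\mathbb J^{-n}$ and $\vec{i_2'}\in\mathbb J^{n+n'}$, then $[(g,x,\vec i,n)]\cdot[(g',\alpha^n(x),\vec{i'},n')]=[(c^{(-n)}_{\vec{i_1'},\sigma_{-n}(\vec i)}(\alpha^n(x))\,gg',x,\vec{i_2'},n+n')]$. (g) If $|n'|>n>0>n'$ and $\vec{i'}=(\vec{i_1'},\vec{i_2'})\in\mathbb J^{-n'}$ with $\vec{i_1'}\in\mathbb J^n$ and $\vec{i_2'}\in\mathbb J^{-n'-n}$, then $[(g,x,\vec i,n)]\cdot[(g',\alpha^n(x),\vec{i'},n')]=[(c^{(n)}_{\vec i,\sigma_n(\vec{i_1'})}(x)\,gg',x,\vec{i_2'},n+n')]$. (h) If $n>|n'|>0>n'$ and $\vec i=(\vec{i_1},\vec{i_2})\in\mathbb J^n$ with $\vec{i_1}\in\mathbb J^{n+n'}$ and $\vec{i_2}\in\mathbb J^{-n'}$, then $[(g,x,\vec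 i,n)]\cdot[(g',\alpha^n(x),\vec{i'},n')]=[(c^{(-n')}_{\vec{i_2},\sigma_{-n'}(\vec{i'})}(\alpha^{n+n'}(x))\,gg',x,\vec{i_1},n+n')]$. Moreover, for $[(g,x,\vec i,n)]\in\Lambda_n\subset\Lambda$, the inverse operation maps $\Lambda_n$ to $\Lambda_{-n}$ and is given by $[(g,x,\vec i,n)]^{-1}=[(g^{-1},\alpha^n(x),\sigma_{|n|}(\vec i),-n)]$.
   Context: **Transformation groupoid.** $\Gamma=X\times_\alpha\mathbb Z$ is $X\times\mathbb Z$ with $r(x,n)=x$, $s(x,n)=\alpha^n(x)$, $(x,m)(\alpha^m(x),n)=(x,m+n)$, $(x,n)^{-1}=(\alpha^n(x),-n)$, $\Gamma^{(0)}=X\times\{0\}$. **Transition functions.** $\mathbb J$ is a finite index set and the $c_{i,j}:U_i\cap U_j\to G$ are continuous with $c_{i,i}\equiv 1_G$, $c_{i,j}(x)=[c_{j,i}(x)]^{-1}$ and $c_{i,j}(x)c_{j,k}(x)=c_{i,k}(x)$ on the respective intersections. Up to equivalence, $E$ is the quotient of $\bigsqcup_{i\in\mathbb J}G\times U_i\times\{i\}$ by $(g_1,b_1,i)\sim(g_2,b_2,j)$ iff $b_1=b_2\in U_i\cap U_j$ and $g_1c_{i,j}(b_1)=g_2$. **Multi-indices.** For $n>0$, $\mathbb J^n$ is the $n$-fold Cartesian power, $\pi_k:\mathbb J^n\to\mathbb J$ is the $k$-th coordinate, $\sigma_n:\mathbb J^n\to\mathbb J^n$ is the flip $\sigma_n(i_1,\dots,i_n)=(i_n,\dots,i_1)$,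 and $(\vec i,\vec{i'})$ denotes concatenation. $\mathbb J^0=\{1\}$ is a one-point index set, $\sigma_0$ is the identity, and concatenating with the element $1\in\mathbb J^0$ leaves the other multi-index unchanged. **The bundles $\Lambda_n$.** - $n=0$: $\Lambda_0=G\times X\times\{1\}\times\{0\}$ (trivial bundle, only trivial identifications). - $n>0$: for $\vec i\in\mathbb J^n$ let $U_{\vec i}=\bigcap_{k=1}^n\alpha^{-(k-1)}(U_{\pi_k(\vec i)})$, and for $x\in U_{\vec i}\cap U_{\vec j}$ let $c^{(n)}_{\vec i,\vec j}(x)=\prod_{k=1}^n c_{\pi_k(\vec i),\pi_k(\vec j)}(\alpha^{k-1}(x))$. $\Lambda_n$ is the quotient of $\bigsqcup_{\vec i\in\mathbb J^n}G\times U_{\vec i}\times\{\vec i\}\times\{n\}$ by $(g,x,\vec i,n)\sim(h,x,\vec j,n)$ iff $x\in U_{\vec i}\cap U_{\vec j}$ and $h=c^{(n)}_{\vec i,\vec j}(x)g$. - $n<0$: let $W_i=\alpha(U_i)$; for $\vec i\in\mathbb J^{|n|}$ let $W_{\vec i}=\bigcap_{k=1}^{|n|}\alpha^{k-1}(W_{\pi_k(\vec i)})$, and for $x\in W_{\vec i}\cap W_{\vec j}$ let $c^{(n)}_{\vec i,\vec j}(x)=\prod_{k=1}^{|n|}[c_{\pi_k(\vec i),\pi_k(\vec j)}(\alpha^{-k}(x))]^{-1}$. $\Lambda_n$ is the quotient of $\bigsqcup_{\vec i\in\mathbb J^{|n|}}G\times W_{\vec i}\times\{\vec i\}\times\{n\}$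 by $(g,x,\vec i,n)\sim(h,x,\vec j,n)$ iff $x\in W_{\vec i}\cap W_{\vec j}$ and $h=c^{(n)}_{\vec i,\vec j}(x)g$. Each $\Lambda_n$ has the quotient topology and is a principal $G$-bundle over $X\times\{n\}$; $\Lambda=\bigsqcup_{n\in\mathbb Z}\Lambda_n$ has the disjoint union topology. $[\cdot]$ denotes equivalence classes. **Unit space, range, source.** $\Lambda^{(0)}=\{(1_G,x,0):x\in X\}$, embedded in $\Lambda_0$ by $(1_G,x,0)\mapsto(1_G,x,1,0)$. For every $n\in\mathbb Z$, $r([(g,x,\vec i,n)])=(1_G,x,0)$ and $s([(g,x,\vec i,n)])=(1_G,\alpha^n(x),0)$. *)

(* Defs.v *)
From HB Require Import structures.
From mathcomp Require Import all_boot all_order all_algebra.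
From mathcomp Require Import all_classical all_reals all_analysis.

Set Implicit Arguments.
Unset Strict Implicit.
Unset Printing Implicit Defensive.

Import Order.TTheory GRing.Theory Num.Theory.
Local Open Scope classical_set_scope.
Local Open Scope ring_scope.

(** Groupoids, in Renault's axiomatization: units, range and source are
    derived. [gmul] is total, but only its values on composable pairs matter. *)

Record groupoid (T : Type) := Groupoid {
  composable : T -> T -> Prop;
  gmul : T -> T -> T;
  ginv : T -> T;
  ginvK : involutive ginv;
  gmulA : forall a b c, composable a b -> composable b c ->
    [/\ composable (gmul a b) c, composable a (gmul b c)
      & gmul (gmul a b) c = gmul a (gmul b c)];
  gcompV : forall a, composable (ginv a) a;
  gmulKV : forall a b, composable a b -> gmul (ginv a) (gmul a b) = b;
  gmulVK : forall a b, composable b a -> gmul (gmul b a) (ginv a) = b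
}.

Definition grange (T : Type) (S : groupoid T) (a : T) := gmul S a (ginv S a).
Definition gsource (T : Type) (S : groupoid T) (a : T) := gmul S (ginv S a) a.
Definition gunits (T : Type) (S : groupoid T) : set T := range (grange S).

Definition topological_groupoid (T : topologicalType) (S : groupoid T) : Prop :=
  continuous (ginv S) /\
  {within [set p : T * T | composable S p.1 p.2],
    continuous (fun p : T * T => gmul S p.1 p.2)}.

Definition is_homeomorphism (S T : topologicalType) (f : S -> T) : Prop :=
  continuous f /\
  exists g : T -> S, [/\ continuous g, cancel f g & cancel g f].

Record self_homeo (X : topologicalType) := SelfHomeo {
  sh_fun :> X -> X;
  sh_inv : X -> X;
  sh_continuous : continuous sh_fun;
  sh_inv_continuous : continuous sh_inv;
  sh_funK : cancel sh_fun sh_inv;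
  sh_invK : cancel sh_inv sh_fun
}.

Section Transformation_groupoid.
Context (X : topologicalType) (alpha : self_homeo X).

Definition hpow (n : int) : X -> X :=
  match n with
  | Posz k => iter k alpha
  | Negz k => iter k.+1 (sh_inv alpha)
  end.

Lemma hpow_succ (n : int) x : hpow (1 + n) x = alpha (hpow n x).
Proof.
case: n => [//|[|k]]; first by rewrite /= sh_invK.
have -> : 1 + Negz k.+1 = Negz k by rewrite !NegzE (intS k.+1) opprD addrA subrr add0r.
by rewrite /= sh_invK.
Qed.

Lemma hpow_pred (n : int) x : hpow (-1 + n) x = sh_inv alpha (hpow n x).
Proof.
by rewrite -[in RHS](subrK 1 n) [n - 1 + 1]addrC hpow_succ sh_funK addrC.
Qed.

Lemma hpowD (m n : int) x : hpow (m + n) x = hpow m (hpow n x).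
Proof.
elim: m => [|k IH|k IH]; first by rewrite add0r.
- by rewrite intS -addrA !hpow_succ IH.
- by rewrite intS opprD -addrA !hpow_pred IH.
Qed.

Lemma hpowK (n : int) x : hpow (- n) (hpow n x) = x.
Proof. by rewrite -hpowD addNr. Qed.

Definition Gamma : topologicalType := (X * discrete_topology int)%type.

Definition Gamma_composable (a b : Gamma) : Prop := hpow (a.2 : int) a.1 = b.1.
Definition Gamma_mul (a b : Gamma) : Gamma := (a.1, (a.2 : int) + (b.2 : int)).
Definition Gamma_inv (a : Gamma) : Gamma :=
  (hpow (a.2 : int) a.1, - (a.2 : int)).

Definition Gamma_groupoid : groupoid Gamma.
Proof.
refine (@Groupoid Gamma Gamma_composable Gamma_mul Gamma_inv _ _ _ _ _).
- by case=> x n; rewrite /Gamma_inv /= hpowK opprK.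
- move=> [x m] [y n] [z p]; rewrite /Gamma_composable /Gamma_mul /= => <- <-.
  by rewrite addrA; split=> //; rewrite addrC hpowD.
- by case=> x n; exact: hpowK.
- by move=> [x m] [y n]; rewrite /Gamma_composable /Gamma_mul /= => <-; rewrite addKr.
- by move=> [x m] [y n] _; rewrite /Gamma_mul /= addrK.
Defined.

Definition Gamma_unit_space : set Gamma := [set u | (u.2 : int) = 0].

Lemma Gamma_unitsE : gunits Gamma_groupoid = Gamma_unit_space.
Proof.
apply/seteqP; split=> [_ [[x n] _ <-]|[x n] n0]; first exact: subrr.
by exists (x, n) => //; congr (_, _); rewrite [RHS]n0; exact: subrr.
Qed.

End Transformation_groupoid.

Arguments Gamma_unit_space X _ : clear implicits.

(** Gluing the pieces [G * dom i] along a [G]-valued cocycle: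
    [(g, x, i) ~ (h, x, j)] iff [h = trans i j x + g]. The abelian group [G] is
    written additively. [trans i j] is a total function, constrained only on
    [dom i `&` dom j]. *)

Record gluing (X : topologicalType) (G : topologicalZmodType) (K : choiceType) :=
Gluing {
  dom : K -> set X;
  trans : K -> K -> X -> G;
  trans_id : forall i x, dom i x -> trans i i x = 0;
  trans_opp : forall i j x, dom i x -> dom j x -> trans i j x = - trans j i x;
  trans_cocycle : forall i j k x, dom i x -> dom j x -> dom k x ->
    trans i j x + trans j k x = trans i k x
}.

Section Glue.
Local Open Scope quotient_scope.
Context (X : topologicalType) (G : topologicalZmodType) (K : choiceType).
Context (D : gluing X G K).

Definition pieces : topologicalType := {i : K & (G * dom D i)%type}.

Definition piece (i : K) (g : G) (x : dom D i) : pieces :=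
  existT (fun i => (G * dom D i)%type) i (g, x).

Definition piece_pt (a : pieces) : X := \val (projT2 a).2.

Definition glue_rel (a b : pieces) : bool :=
  `[< piece_pt a = piece_pt b /\
      (projT2 b).1 =
        trans D (projT1 a) (projT1 b) (piece_pt a) + (projT2 a).1 >].

Lemma piece_pt_dom (a : pieces) : dom D (projT1 a) (piece_pt a).
Proof. exact: set_valP. Qed.

Lemma glue_rel_refl : reflexive glue_rel.
Proof.
by move=> a; apply/asboolP; rewrite trans_id ?add0r//; exact: piece_pt_dom.
Qed.

Lemma glue_rel_sym : symmetric glue_rel.
Proof.
suff H a b : glue_rel a b -> glue_rel b a by move=> a b; apply/idP/idP; exact: H.
move=> /asboolP[ab bE]; apply/asboolP; split=> //.
have := piece_pt_dom b; rewrite -ab => bd.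
by rewrite bE (trans_opp bd (piece_pt_dom a)) addKr.
Qed.

Lemma glue_rel_trans : transitive glue_rel.
Proof.
move=> b a c /asboolP[ab bE] /asboolP[bc cE]; apply/asboolP.
split; first by rewrite ab.
have := piece_pt_dom b; have := piece_pt_dom c; rewrite -bc -ab => cd bd.
rewrite cE bE -ab addrA -(trans_cocycle (piece_pt_dom a) bd cd).
by rewrite (addrC (trans _ _ _ _)).
Qed.

Canonical glue_equiv := EquivRel glue_rel glue_rel_refl glue_rel_sym glue_rel_trans.

Definition glued : topologicalType := quotient_topology {eq_quot glue_equiv}.

Definition glue_class (i : K) (g : G) (x : dom D i) : glued :=
  \pi_({eq_quot glue_equiv}) (piece g x).

Definition glue_proj (a : glued) : X :=
  piece_pt (repr (a : {eq_quot glue_equiv})).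

Lemma glue_projE i g (x : dom D i) : glue_proj (glue_class g x) = \val x.
Proof.
rewrite /glue_proj /glue_class.
by case: piP => b /eqmodP /asboolP[<- _].
Qed.

Lemma glue_classE i j g h (x : dom D i) (y : dom D j) :
  glue_class g x = glue_class h y <->
  \val x = \val y /\ h = trans D i j (\val x) + g.
Proof.
split=> [/eqmodP /asboolP//|H].
by apply/eqmodP/asboolP.
Qed.

End Glue.

(** A principal [G]-bundle [(E, p, X)], given by a finite open cover and
    continuous transition functions: [E] is [bundle_space] and [p] is
    [bundle_proj]. *)

Record bundle_data (X : topologicalType) (G : topologicalZmodType) (J : finType) :=
BundleData {
  bundle_gluing :> gluing X G J;
  cover_open : forall i, open (dom bundle_gluing i);
  cover_full : \bigcup_i dom bundle_gluing i = [set: X];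
  trans_continuous : forall i j,
    {within dom bundle_gluing i `&` dom bundle_gluing j,
      continuous (trans bundle_gluing i j)}
}.

Definition bundle_space X G J (E : bundle_data X G J) : topologicalType := glued E.
Definition bundle_proj X G J (E : bundle_data X G J) : bundle_space E -> X :=
  @glue_proj _ _ _ E.

(** The index set [J^|n|]. *)
Notation multi_index J n := ((absz n%R).-tuple J).

Section Lambda.
Context (X : topologicalType) (G : topologicalZmodType) (J : finType).
Context (alpha : self_homeo X) (E : bundle_data X G J).

(** Coordinates of a tuple are numbered from 0: the factor number [k] of the
    usual 1-based numbering is the factor [k - 1] here. For [n = 0] the only
    multi-index is [[tuple]], with domain [setT] and trivial cocycle, so that the
    gluing identifies nothing and gives [G * X]. *)

Definition multi_dom (n : int) (i : multi_index J n) : set X :=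
  if 0 <= n then
    \bigcap_(k : 'I_`|n|%N) (hpow alpha (- (k : nat)%:Z) @` dom E (tnth i k))
  else
    \bigcap_(k : 'I_`|n|%N)
      (hpow alpha (k : nat)%:Z @` (alpha @` dom E (tnth i k))).

Definition multi_trans (n : int) (i j : multi_index J n) (x : X) : G :=
  if 0 <= n then
    \sum_(k < `|n|%N) trans E (tnth i k) (tnth j k) (hpow alpha (k : nat)%:Z x)
  else
    \sum_(k < `|n|%N)
      - trans E (tnth i k) (tnth j k) (hpow alpha (- (k : nat).+1%:Z) x).

Lemma multi_domP (n : int) (i : multi_index J n) (x : X) (k : 'I_`|n|%N) :
  multi_dom i x ->
  dom E (tnth i k)
    (hpow alpha (if 0 <= n then (k : nat)%:Z else - (k : nat).+1%:Z) x).
Proof.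
rewrite /multi_dom; case: ifP => _ /(_ k I)[y yd <-].
  by rewrite -hpowD subrr.
case: yd => z zd <-.
by rewrite intS opprD hpowD hpowK /= sh_funK.
Qed.

Lemma multi_trans_id n (i : multi_index J n) x :
  multi_dom i x -> multi_trans i i x = 0.
Proof.
move=> ix; rewrite /multi_trans.
have := fun k => multi_domP k ix.
case: ifP => _ H; apply: big1 => k _; rewrite trans_id ?oppr0//; exact: H.
Qed.

Lemma multi_trans_opp n (i j : multi_index J n) x :
  multi_dom i x -> multi_dom j x -> multi_trans i j x = - multi_trans j i x.
Proof.
move=> ix jx; rewrite /multi_trans.
have := fun k => multi_domP k ix; have := fun k => multi_domP k jx.
case: ifP => _ Hj Hi; rewrite -sumrN; apply: eq_bigr => k _;
  by rewrite [in LHS](trans_opp (Hi k) (Hj k)).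
Qed.

Lemma multi_trans_cocycle n (i j k : multi_index J n) x :
  multi_dom i x -> multi_dom j x -> multi_dom k x ->
  multi_trans i j x + multi_trans j k x = multi_trans i k x.
Proof.
move=> ix jx kx; rewrite /multi_trans.
have := fun l => multi_domP l kx.
have := fun l => multi_domP l ix; have := fun l => multi_domP l jx.
case: ifP => _ Hj Hi Hk; rewrite -big_split/=; apply: eq_bigr => l _;
  by rewrite -?opprD (trans_cocycle (Hi l) (Hj l) (Hk l)).
Qed.

Definition Lambda_gluing (n : int) : gluing X G (multi_index J n) :=
  Gluing (@multi_trans_id n) (@multi_trans_opp n) (@multi_trans_cocycle n).

Definition Lambda_ (n : int) : topologicalType := glued (Lambda_gluing n).

Definition Lambda : topologicalType := {n : int & Lambda_ n}.

Definition Lambda_class (n : int) (i : multi_index J n) (g : G)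
    (x : dom (Lambda_gluing n) i) : Lambda :=
  existT Lambda_ n (glue_class g x).

(** [is_class a g x i n] is [a = [(g, x, i, n)]]; it includes that [i] has length
    [|n|] and that [x] lies in the domain of the chart [i]. *)
Definition is_class (a : Lambda) (g : G) (x : X) (i : seq J) (n : int) : Prop :=
  exists (t : multi_index J n) (u : dom (Lambda_gluing n) t),
    [/\ tval t = i, \val u = x & a = Lambda_class g u].

Lemma dom0_full (x : X) : x \in dom (Lambda_gluing 0) [tuple].
Proof. by apply/mem_set; rewrite /= /multi_dom lexx => -[]. Qed.

Definition Lambda_unit (x : X) : Lambda :=
  @Lambda_class 0 [tuple] 0 (SigSub (dom0_full x)).

Definition Lambda_unit_space : set Lambda := range Lambda_unit.

Definition Lambda_range (a : Lambda) : Lambda :=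
  Lambda_unit (glue_proj (projT2 a)).

Definition Lambda_source (a : Lambda) : Lambda :=
  Lambda_unit (hpow alpha (projT1 a) (glue_proj (projT2 a))).

Lemma is_class_unit x : is_class (Lambda_unit x) 0 x [::] 0.
Proof. by exists [tuple], (SigSub (dom0_full x)). Qed.

Lemma is_class_range a g x i n : is_class a g x i n ->
  Lambda_range a = Lambda_unit x.
Proof. by case=> t [u [_ <- ->]]; rewrite /Lambda_range glue_projE. Qed.

Lemma is_class_source a g x i n : is_class a g x i n ->
  Lambda_source a = Lambda_unit (hpow alpha n x).
Proof. by case=> t [u [_ <- ->]]; rewrite /Lambda_source glue_projE. Qed.

Lemma is_class_inj a b g x i n : is_class a g x i n -> is_class b g x i n -> a = b.
Proof.
move=> [t [u [<- <- ->]]] [t' [u' [/val_inj tt uu ->]]].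
by move: u' uu; rewrite tt => u' /val_inj ->.
Qed.

End Lambda.

Arguments Lambda_unit_space {X G J} alpha E _.
Arguments Lambda_unit {X G J} alpha E _.

(* Main.v *)
(** Choose a reference chart at every point of [X], without any continuity.
    Reading the [G]-coordinate of an element of [Lambda_ n] over [x] in the
    reference charts met along [x], [alpha x], ..., [alpha^(n-1) x] identifies the
    set [Lambda] with [G * X * int], and the product and inverse of the theorem
    become [(g, x, n) (h, alpha^n x, m) = (g + h, x, n + m)] and
    [(g, x, n)^-1 = (- g, alpha^n x, - n)], so the groupoid axioms are free. The
    cases (a)-(h) are the identities between sums of transition functions along
    the itinerary that goes [n] steps and then [n'] steps, where the part run
    through in both directions contributes the [multi_trans] factor.

    For the topology, the charts of [Lambda_ n] are open and, in charts
    [i], [i'], [k], the product is [(g, x), (g', alpha^n x) |-> (F x + g + g', x)].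
    Changing the reference charts adds to the sums defining [F] a function of the
    time alone, which telescopes to zero. Hence [F] may be computed near [x0] with
    the reference charts of the orbit of [x0] kept fixed, and is then a finite sum
    of continuous functions. *)

Require Import Defs.
From HB Require Import structures.
From mathcomp Require Import all_boot all_order all_algebra.
From mathcomp Require Import all_classical all_reals all_analysis.
From mathcomp Require Import zify.

Set Implicit Arguments.
Unset Strict Implicit.
Unset Printing Implicit Defensive.

Import Order.TTheory GRing.Theory Num.Theory.
Local Open Scope classical_set_scope.
Local Open Scope ring_scope.

(** * Itineraries *)

Section Itineraries.
Context (J : finType).

(* The pairs (chart, time) met by a multi-index: forwards from time [s], and
   backwards from time [s - 1]. *)

Fixpoint upath (s : int) (i : seq J) : seq (J * int) :=
  if i is j :: i' then (j, s) :: upath (s + 1) i' else [::].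

Fixpoint dpath (s : int) (i : seq J) : seq (J * int) :=
  if i is j :: i' then (j, s - 1) :: dpath (s - 1) i' else [::].

Definition vpath (n s : int) (i : seq J) := if 0 <= n then upath s i else dpath s i.

Lemma upath_cat s i i' :
  upath s (i ++ i') = upath s i ++ upath (s + (size i)%:Z) i'.
Proof.
elim: i s => [|j i IH] s; first by rewrite addr0.
by rewrite /= IH -addrA -intS.
Qed.

Lemma dpath_cat s i i' :
  dpath s (i ++ i') = dpath s i ++ dpath (s - (size i)%:Z) i'.
Proof.
elim: i s => [|j i IH] s; first by rewrite subr0.
by rewrite /= IH -addrA -opprD -intS.
Qed.

Lemma dpath_rev s i : dpath (s + (size i)%:Z) (rev i) = rev (upath s i).
Proof.
elim: i s => [//|j i IH] s.
rewrite rev_cons -cats1 dpath_cat /= rev_cons -cats1 -IH size_rev.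
by congr (dpath _ _ ++ [:: (_, _)]); lia.
Qed.

Lemma upath_rev s i : upath (s - (size i)%:Z) (rev i) = rev (dpath s i).
Proof.
rewrite -[i in RHS]revK -[s in RHS](subrK (size i)%:Z) -[size i in RHS]size_rev.
by rewrite dpath_rev revK size_rev.
Qed.

(** A backward step from [s] is recorded at time [s - 1], where the forward step that it undoes
    starts. Retracing an itinerary from its endpoint thus meets the same pairs in reverse order,
    whence the flip in inverses and mixed products. *)
Lemma vpath_rev n s i : size i = `|n|%N ->
  vpath (- n) (s + n) (rev i) = rev (vpath n s i).
Proof.
rewrite /vpath; case: n => -[|n].
- by move=> /size0nil ->.
- by rewrite -dpath_rev => ->.
- by rewrite -upath_rev => ->.
- by rewrite -upath_rev => ->.
Qed.

Lemma upath_shift s t i : upath (s + t) i = [seq (q.1, q.2 + t) | q <- upath s i].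
Proof. by elim: i s => [//|j i IH] s; rewrite /= -IH addrAC. Qed.

Lemma dpath_shift s t i : dpath (s + t) i = [seq (q.1, q.2 + t) | q <- dpath s i].
Proof. by elim: i s => [//|j i IH] s; rewrite /= -IH addrAC. Qed.

Lemma vpath_shift n s t i :
  vpath n (s + t) i = [seq (q.1, q.2 + t) | q <- vpath n s i].
Proof. by rewrite /vpath; case: ifP => _; [exact: upath_shift|exact: dpath_shift]. Qed.

Lemma upath_tnth m (t : m.-tuple J) s :
  upath s t = [seq (tnth t k, s + (k : nat)%:Z) | k <- enum 'I_m].
Proof.
elim: m t s => [t|m IH t] s; first by rewrite enum_ord0 tuple0.
case/tupleP: t => j t; rewrite enum_ordSl /= addr0 IH -map_comp.
congr (_ :: _); apply: eq_map => k /=; rewrite tnthS /=; congr (_, _).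
rewrite /bump /=; lia.
Qed.

Lemma dpath_tnth m (t : m.-tuple J) s :
  dpath s t = [seq (tnth t k, s - (k : nat).+1%:Z) | k <- enum 'I_m].
Proof.
elim: m t s => [t|m IH t] s; first by rewrite enum_ord0 tuple0.
case/tupleP: t => j t; rewrite enum_ordSl /= IH -map_comp.
congr (_ :: _); apply: eq_map => k /=; rewrite tnthS /=; congr (_, _).
rewrite /bump /=; lia.
Qed.

Lemma vpath_tnth n (t : multi_index J n) s :
  vpath n s t =
    [seq (tnth t k, s + if 0 <= n then (k : nat)%:Z else - (k : nat).+1%:Z)
      | k <- enum 'I_`|n|%N].
Proof.
by rewrite /vpath; case: ifP => _; [exact: upath_tnth|exact: dpath_tnth].
Qed.

Lemma vpath_follow (f : int -> J) n s :
  exists2 i : seq J, size i = `|n|%N & {in vpath n s i, forall q, q.1 = f q.2}.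
Proof.
suff [U D] : (forall m s, exists2 i : seq J, size i = m &
    {in upath s i, forall q, q.1 = f q.2}) /\
  (forall m s, exists2 i : seq J, size i = m &
    {in dpath s i, forall q, q.1 = f q.2}).
  by rewrite /vpath; case: (0 <= n); [exact: U|exact: D].
split; elim=> [|m IH] t; try by exists [::].
- have [i im iH] := IH (t + 1); exists (f t :: i); first by rewrite /= im.
  by move=> q; rewrite inE => /predU1P[->//|]; exact: iH.
- have [i im iH] := IH (t - 1); exists (f (t - 1) :: i); first by rewrite /= im.
  by move=> q; rewrite inE => /predU1P[->//|]; exact: iH.
Qed.

(** * Signed sums along an itinerary *)

Context (G : zmodType).
Implicit Types e : J -> int -> G.

(** A discrete oriented integral: the minus sign on backward itineraries matches the inverted
    transition functions for [n < 0]. *)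
Definition vsum e (n s : int) (i : seq J) : G :=
  if 0 <= n then \sum_(q <- upath s i) e q.1 q.2
  else - \sum_(q <- dpath s i) e q.1 q.2.

Lemma vsumE e n s i :
  vsum e n s i =
  \sum_(q <- vpath n s i) (if 0 <= n then e q.1 q.2 else - e q.1 q.2).
Proof. by rewrite /vsum /vpath; case: ifP => // _; rewrite sumrN. Qed.

Lemma vsum_rev e n s i : size i = `|n|%N ->
  vsum e (- n) (s + n) (rev i) = - vsum e n s i.
Proof.
move=> sz; have := vpath_rev s sz; rewrite /vsum /vpath.
case: n sz => -[|n] sz; first by rewrite (size0nil sz) oppr0 /= !big_nil oppr0.
- by move=> /= ->; rewrite big_rev.
- by move=> /= ->; rewrite big_rev opprK.
- by move=> /= ->; rewrite big_rev opprK.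
Qed.

Lemma eq_vsum e e' n s i :
  {in vpath n s i, forall q, e q.1 q.2 = e' q.1 q.2} ->
  vsum e n s i = vsum e' n s i.
Proof.
move=> H; rewrite !vsumE !big_seq; apply: eq_bigr => q /H ->; by case: ifP.
Qed.

Lemma vsumD e e' n s i :
  vsum (fun j p => e j p + e' j p) n s i = vsum e n s i + vsum e' n s i.
Proof.
by rewrite !vsumE -big_split; apply: eq_bigr => q _; case: ifP; rewrite ?opprD.
Qed.

Lemma vsum_shift e n s t i :
  vsum (fun j p => e j (p + t)) n s i = vsum e n (s + t) i.
Proof. by rewrite !vsumE vpath_shift big_map. Qed.

(** A discrete primitive, summed from 0 in both directions; it serves to evaluate sums of functions
    of time alone. *)
Lemma antidifference (f : int -> G) :
  exists A : int -> G, forall p, A (p + 1) = A p + f p.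
Proof.
pose A (p : int) := match p with
  | Posz m => \sum_(k < m) f k
  | Negz m => - \sum_(k < m.+1) f (- (k : nat).+1%:Z) end.
exists A => -[m|[|m]].
- by rewrite (_ : Posz m + 1 = m.+1) ?/A ?big_ord_recr//; lia.
- by rewrite /A /= big_ord0 big_ord1 addNr.
- have -> : Negz m.+1 + 1 = Negz m by lia.
  by rewrite /A [in RHS]big_ord_recr /= NegzE opprD addrNK.
Qed.

(** The fundamental theorem of calculus for [vsum]: only the endpoints matter, whatever charts are
    met in between. *)
Lemma vsum_telescope (f A : int -> G) n s i :
  (forall p, A (p + 1) = A p + f p) -> size i = `|n|%N ->
  vsum (fun _ => f) n s i = A (s + n) - A s.
Proof.
move=> AS; rewrite /vsum; case: ifP => n0 szi.
  have -> : n = (size i)%:Z by lia.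
  elim: i s {n0 szi} => [|j i IH] s /=; first by rewrite big_nil addr0 subrr.
  rewrite big_cons IH AS /= (_ : s + 1 + (size i)%:Z = s + (size i).+1%:Z); last by lia.
  by rewrite opprD addrC addrA subrK.
have -> : n = - (size i)%:Z by lia.
elim: i s {n0 szi} => [|j i IH] s /=; first by rewrite big_nil oppr0 subr0 subrr.
rewrite big_cons opprD IH -[in - A s](subrK 1 s) AS.
rewrite (_ : s - 1 - (size i)%:Z = s - (size i).+1%:Z); last by lia.
by rewrite opprD addrC addrA.
Qed.

End Itineraries.

(** * The groupoid structure *)

Section LambdaAlgebra.
Context (X : topologicalType) (G : topologicalZmodType) (J : finType).
Context (alpha : self_homeo X) (E : bundle_data X G J).

Local Notation Lam := (Lambda alpha E).
Definition deg (a : Lam) : int := projT1 a.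
Definition pt (a : Lam) : X := glue_proj (projT2 a).
Implicit Types (a b : Lam) (x y : X) (n s t : int) (g h : G) (i : seq J).

(** * Charts and cocycles of [Lambda_ n] along an orbit *)

Definition visits (x : X) (s : seq (J * int)) : Prop :=
  {in s, forall q, dom E q.1 (hpow alpha q.2 x)}.

Lemma cover_ex y : exists j, dom E j y.
Proof. by have := I : setT y; rewrite -(cover_full E) => -[j _]; exists j. Qed.

Definition ref_chart y : J := projT1 (cid (cover_ex y)).

Lemma ref_chartP y : dom E (ref_chart y) y.
Proof. exact: projT2 (cid (cover_ex y)). Qed.

(* The coordinate change, at time [p] of the orbit of [x], from the chart [j] to
   the reference chart of the point reached. *)
Definition orbit_trans (x : X) (j : J) (p : int) : G :=
  trans E j (ref_chart (hpow alpha p x)) (hpow alpha p x).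

Lemma trans_sub (i j k : J) y : dom E i y -> dom E j y -> dom E k y ->
  trans E i k y - trans E j k y = trans E i j y.
Proof. by move=> yi yj yk; rewrite -(trans_cocycle yi yj yk) addrK. Qed.

Lemma multi_domE n (i : multi_index J n) x :
  multi_dom alpha E i x <-> visits x (vpath n 0 i).
Proof.
split=> [xi q|H].
  rewrite vpath_tnth => /mapP[k _ ->] /=; rewrite add0r; exact: multi_domP.
have {}H k : dom E (tnth i k)
    (hpow alpha (if 0 <= n then (k : nat)%:Z else - (k : nat).+1%:Z) x).
  have := H (tnth i k, 0 + if 0 <= n then (k : nat)%:Z else - (k : nat).+1%:Z).
  by rewrite /= add0r vpath_tnth; apply; apply/mapP; exists k; rewrite ?mem_enum ?add0r.
rewrite /multi_dom; case: ifPn => n0 k _; have := H k; rewrite ?n0 ?(negbTE n0).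
  by move=> xk; exists (hpow alpha k x) => //; rewrite hpowK.
move=> xk; exists (alpha (hpow alpha (- (k : nat).+1%:Z) x)).
  by eexists; first exact: xk.
by rewrite -hpow_succ -hpowD (_ : _ + _ = 0)//; lia.
Qed.

(** The cocycle becomes a coboundary: each transition factors through the reference chart at the
    same point, so it splits into a part depending on [i] and a part depending on [j]. *)
Lemma multi_transE n (i j : multi_index J n) x :
  visits x (vpath n 0 i) -> visits x (vpath n 0 j) ->
  multi_trans alpha E i j x =
  vsum (orbit_trans x) n 0 i - vsum (orbit_trans x) n 0 j.
Proof.
move=> /multi_domE xi /multi_domE xj.
rewrite !vsumE !vpath_tnth !big_map /multi_trans -sumrB.
have H k := trans_sub (multi_domP k xi) (multi_domP k xj) (ref_chartP _).
move: H; case: ifPn => n0 H; apply: eq_big => // k _; rewrite /= add0r -H //.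
by rewrite opprB opprK addrC.
Qed.

Lemma is_class_parts a g x i n : is_class a g x i n ->
  [/\ size i = `|n|%N, visits x (vpath n 0 i), deg a = n & pt a = x].
Proof.
case=> t [u [<- <- ->]]; split; rewrite /deg /pt ?size_tuple ?glue_projE//.
by apply/multi_domE; exact: set_valP.
Qed.

Lemma is_class_intro n i g x : size i = `|n|%N -> visits x (vpath n 0 i) ->
  exists a : Lam, is_class a g x i n.
Proof.
move=> /eqP sz xi; pose t : multi_index J n := Tuple sz.
have xt : x \in dom (Lambda_gluing alpha E n) t by apply/mem_set/multi_domE.
by exists (Lambda_class g (SigSub xt)), t, (SigSub xt).
Qed.

Local Open Scope quotient_scope.

Lemma ex_class (a : Lam) : exists g i, is_class a g (pt a) i (deg a).
Proof.
case: a => n q; rewrite /deg /pt /= /glue_proj.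
have := reprK (q : {eq_quot glue_equiv (Lambda_gluing alpha E n)}).
case: (repr _) => i [g u] /= <-.
by exists g, i, i, u; split => //.
Qed.

(** By [multi_transE], the gluing relation preserves the [G]-coordinate corrected by its sum to the
    reference charts; this invariant is the [height] below. *)
Lemma is_class_eq a b g h x i (j : seq J) n : is_class a g x i n -> is_class b h x j n ->
  (a = b <-> g + vsum (orbit_trans x) n 0 i = h + vsum (orbit_trans x) n 0 j).
Proof.
move=> ai bj.
have [_ xi _ _] := is_class_parts ai; have [_ xj _ _] := is_class_parts bj.
case: ai xi bj xj => t [u [<- <- ->]] xi [t' [u' [<- uu ->]]] xj.
transitivity (h = multi_trans alpha E t t' (\val u) + g).
  rewrite /Lambda_class; split=> [/(@existT_inj2 _ _ _ _ _) /glue_classE[]//|hE].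
  by congr existT; apply/glue_classE.
rewrite multi_transE//; split=> [->|H].
  by rewrite addrAC subrK addrC.
by rewrite addrAC (addrC _ g) H addrK.
Qed.

(* The second coordinate of [a] in the trivialization of [Lambda] over the
   (discrete) orbits of [alpha] given by the reference charts. *)
Lemma ex_height (a : Lam) : exists h, forall g i, is_class a g (pt a) i (deg a) ->
  h = g + vsum (orbit_trans (pt a)) (deg a) 0 i.
Proof.
have [g [i ai]] := ex_class a.
exists (g + vsum (orbit_trans (pt a)) (deg a) 0 i) => h j aj.
exact/(is_class_eq ai aj).
Qed.

Definition height (a : Lam) : G := projT1 (cid (ex_height a)).

Lemma is_class_height a g x i n : is_class a g x i n ->
  height a = g + vsum (orbit_trans x) n 0 i.
Proof.
move=> ai; have [_ _ an ax] := is_class_parts ai.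
move: ai; rewrite -an -ax; exact: (projT2 (cid (ex_height a))).
Qed.

(** Degree, base point and height separate elements; with [Lambda_ex] they are coordinates on the
    set [Lambda] in which all the algebra is done. *)
Lemma Lambda_eq a b : deg a = deg b -> pt a = pt b -> height a = height b ->
  a = b.
Proof.
have [g [i ai]] := ex_class a; have [h [j bj]] := ex_class b.
rewrite (is_class_height ai) (is_class_height bj).
move: (deg a) (pt a) (deg b) (pt b) ai bj => n x n' x' ai + nE xE.
rewrite -{n'}nE -{x'}xE.
by move=> bj /(is_class_eq ai bj).
Qed.

Lemma is_classI (a : Lam) g x i n : deg a = n -> pt a = x -> size i = `|n|%N ->
  visits x (vpath n 0 i) -> height a = g + vsum (orbit_trans x) n 0 i ->
  is_class a g x i n.
Proof.
move=> an ax sz xi ha; have [b bi] := is_class_intro g sz xi.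
have [_ _ bn bx] := is_class_parts bi.
suff -> : a = b by [].
by apply: Lambda_eq; rewrite ?an ?ax// ha (is_class_height bi).
Qed.

Lemma Lambda_ex n x h : exists a : Lam, [/\ deg a = n, pt a = x & height a = h].
Proof.
(* With the reference chart at every time, each transition is trivial and the height is the
   [G]-coordinate itself. *)
have [i sz iE] := vpath_follow (fun p => ref_chart (hpow alpha p x)) n 0.
have xi : visits x (vpath n 0 i) by move=> q /iE ->; exact: ref_chartP.
have [a ai] := is_class_intro h sz xi.
have [_ _ an ax] := is_class_parts ai; exists a; split=> //.
rewrite (is_class_height ai) vsumE big_seq big1 ?addr0// => q /iE qE.
by rewrite /orbit_trans qE trans_id ?oppr0 ?if_same//; exact: ref_chartP.
Qed.

Definition Lambda_of n x h : Lam := projT1 (cid (Lambda_ex n x h)).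

Lemma Lambda_ofP n x h : [/\ deg (Lambda_of n x h) = n,
  pt (Lambda_of n x h) = x & height (Lambda_of n x h) = h].
Proof. exact: projT2 (cid (Lambda_ex n x h)). Qed.

(** * Groupoid operations in degree, base point and height *)

Definition Lambda_composable (a b : Lam) : Prop := hpow alpha (deg a) (pt a) = pt b.
Definition Lambda_mul (a b : Lam) : Lam :=
  Lambda_of (deg a + deg b) (pt a) (height a + height b).
Definition Lambda_inv (a : Lam) : Lam :=
  Lambda_of (- deg a) (hpow alpha (deg a) (pt a)) (- height a).

Lemma Lambda_mulE a b : [/\ deg (Lambda_mul a b) = deg a + deg b,
  pt (Lambda_mul a b) = pt a & height (Lambda_mul a b) = height a + height b].
Proof. exact: Lambda_ofP. Qed.

Lemma Lambda_invE a : [/\ deg (Lambda_inv a) = - deg a,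
  pt (Lambda_inv a) = hpow alpha (deg a) (pt a) & height (Lambda_inv a) = - height a].
Proof. exact: Lambda_ofP. Qed.

Definition Lambda_groupoid : groupoid Lam.
Proof.
refine (@Groupoid Lam Lambda_composable Lambda_mul Lambda_inv _ _ _ _ _).
- move=> a; have [n1 x1 h1] := Lambda_invE a.
  have [n2 x2 h2] := Lambda_invE (Lambda_inv a).
  by apply: Lambda_eq; rewrite ?n2 ?x2 ?h2 ?n1 ?x1 ?h1 ?hpowK ?opprK.
- rewrite /Lambda_composable => a b c ab bc.
  have [n1 x1 h1] := Lambda_mulE a b; have [n2 x2 h2] := Lambda_mulE b c.
  have [n3 x3 h3] := Lambda_mulE (Lambda_mul a b) c.
  have [n4 x4 h4] := Lambda_mulE a (Lambda_mul b c).
  split; first by rewrite n1 x1 addrC hpowD ab.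
    by rewrite x2.
  by apply: Lambda_eq; rewrite ?n3 ?n4 ?x3 ?x4 ?h3 ?h4 ?n1 ?n2 ?x1 ?h1 ?h2 ?addrA.
- move=> a; rewrite /Lambda_composable; have [-> -> _] := Lambda_invE a; exact: hpowK.
- move=> a b ab; have [n1 x1 h1] := Lambda_mulE a b; have [n2 x2 h2] := Lambda_invE a.
  have [n3 x3 h3] := Lambda_mulE (Lambda_inv a) (Lambda_mul a b).
  by apply: Lambda_eq; rewrite ?n3 ?x3 ?h3 ?n1 ?h1 ?n2 ?x2 ?h2 ?addKr.
- move=> a b ab; have [n1 x1 h1] := Lambda_mulE b a; have [n2 x2 h2] := Lambda_invE a.
  have [n3 x3 h3] := Lambda_mulE (Lambda_mul b a) (Lambda_inv a).
  by apply: Lambda_eq; rewrite ?n3 ?x3 ?h3 ?n1 ?x1 ?h1 ?n2 ?h2 ?addrK.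
Defined.

Lemma Lambda_unitE x : [/\ deg (Lambda_unit alpha E x) = 0,
  pt (Lambda_unit alpha E x) = x & height (Lambda_unit alpha E x) = 0].
Proof.
have xc := is_class_unit alpha E x; have [_ _ n0 xx] := is_class_parts xc.
by split=> //; rewrite (is_class_height xc) vsumE big_nil addr0.
Qed.

Lemma Lambda_unit_eq x y :
  Lambda_unit alpha E x = Lambda_unit alpha E y <-> x = y.
Proof.
split=> [e|-> //]; have [_ <- _] := Lambda_unitE x.
by rewrite e; have [] := Lambda_unitE y.
Qed.

Lemma Lambda_grange a : grange Lambda_groupoid a = Lambda_range a.
Proof.
have [n1 x1 h1] := Lambda_invE a.
have [n2 x2 h2] := Lambda_mulE a (Lambda_inv a).
have [n3 x3 h3] := Lambda_unitE (pt a).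
by apply: Lambda_eq; rewrite /= ?x2 ?x3 ?n2 ?h2 ?n3 ?h3 ?n1 ?h1 ?subrr.
Qed.

Lemma Lambda_gsource a : gsource Lambda_groupoid a = Lambda_source a.
Proof.
have [n1 x1 h1] := Lambda_invE a.
have [n2 x2 h2] := Lambda_mulE (Lambda_inv a) a.
have [n3 x3 h3] := Lambda_unitE (hpow alpha (deg a) (pt a)).
by apply: Lambda_eq; rewrite /= ?n2 ?x2 ?h2 ?n3 ?x3 ?h3 ?n1 ?x1 ?h1 ?addNr.
Qed.

Lemma Lambda_gunits : gunits Lambda_groupoid = Lambda_unit_space alpha E.
Proof.
apply/seteqP; split=> [_ [a _ <-]|_ [x _ <-]].
  by rewrite Lambda_grange; exists (pt a).
exists (Lambda_unit alpha E x) => //; rewrite Lambda_grange.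
by apply/Lambda_unit_eq; have [] := Lambda_unitE x.
Qed.

(** * Products and inverses in arbitrary charts *)

Lemma visits_shift x n s t i :
  visits (hpow alpha t x) (vpath n s i) <-> visits x (vpath n (s + t) i).
Proof.
rewrite vpath_shift; split=> [H _ /mapP[q /H + ->]|H q qi] /=; rewrite ?hpowD//.
by have := H _ (map_f _ qi); rewrite hpowD.
Qed.

Lemma orbit_trans_shift x t n s i :
  vsum (orbit_trans (hpow alpha t x)) n s i = vsum (orbit_trans x) n (s + t) i.
Proof.
by rewrite -vsum_shift; apply: eq_vsum => q _; rewrite /orbit_trans hpowD.
Qed.

(** Heights add, so in any chart [k] defined at [x] the product has a forced coordinate: [c] is the
    defect between the sums along the two factors and the sum along [k]. Both the product formulas
    and the continuity of multiplication rest on this. *)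
Lemma is_class_mul a b g g' c x i i' k n n' :
  is_class a g x i n -> is_class b g' (hpow alpha n x) i' n' ->
  size k = absz (n + n') -> visits x (vpath (n + n') 0 k) ->
  c + vsum (orbit_trans x) (n + n') 0 k =
    vsum (orbit_trans x) n 0 i + vsum (orbit_trans x) n' n i' ->
  is_class (Lambda_mul a b) (c + g + g') x k (n + n').
Proof.
move=> ai bi' sk xk cE.
have [_ _ an ax] := is_class_parts ai; have [_ _ bn bx] := is_class_parts bi'.
have [n1 x1 h1] := Lambda_mulE a b.
apply: is_classI; rewrite ?n1 ?x1 ?an ?bn//.
(* The second factor starts at [hpow alpha n x]; the shift reads its sum on the orbit of [x], from
   time [n]. *)
rewrite h1 (is_class_height ai) (is_class_height bi') orbit_trans_shift add0r.
by rewrite addrACA -cE addrA [g + g' + c]addrC addrA.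
Qed.

(** When [k] only uses pairs met by [i] or [i'], its domain condition is inherited from the
    factors. *)
Lemma is_class_mul_sub a b g g' c x i i' k n n' :
  is_class a g x i n -> is_class b g' (hpow alpha n x) i' n' ->
  size k = absz (n + n') ->
  {subset vpath (n + n') 0 k <= vpath n 0 i ++ vpath n' n i'} ->
  c + vsum (orbit_trans x) (n + n') 0 k =
    vsum (orbit_trans x) n 0 i + vsum (orbit_trans x) n' n i' ->
  is_class (Lambda_mul a b) (c + g + g') x k (n + n').
Proof.
move=> ai bi' sz sk; apply: is_class_mul => // q /sk.
have [_ xi _ _] := is_class_parts ai; have [_ xi' _ _] := is_class_parts bi'.
rewrite mem_cat => /orP[/xi//|qi'].
by move/visits_shift: xi'; rewrite add0r => /(_ _ qi').
Qed.

(** By [vpath_rev] the reversed index visits the same charts, and its sum changes sign together with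
    the height. *)
Lemma is_class_inv a g x i n : is_class a g x i n ->
  is_class (Lambda_inv a) (- g) (hpow alpha n x) (rev i) (- n).
Proof.
move=> ai; have [sz xi an ax] := is_class_parts ai.
have [n1 x1 h1] := Lambda_invE a.
apply: is_classI; rewrite ?n1 ?x1 ?an ?ax ?size_rev ?sz ?abszN//.
  by apply/visits_shift => q; rewrite vpath_rev// mem_rev; exact: xi.
by rewrite h1 (is_class_height ai) orbit_trans_shift vsum_rev// opprD.
Qed.

End LambdaAlgebra.

(** * Products *)

Section Products.
Context (X : topologicalType) (G : topologicalZmodType) (J : finType).
Context (alpha : self_homeo X) (E : bundle_data X G J).

Local Notation Lam := (Lambda alpha E).
Implicit Types (a b : Lam) (x : X) (n : int) (g : G) (i : seq J).

(** The segment from [s] to [s + m] is run forwards along [j] and backwards along [l]. Flipping [l]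
    makes both forward charts, and [multi_transE] turns their cocycle into the net sum of the round
    trip. *)
Lemma multi_trans_rev (m : int) (j l : multi_index J m) s x : 0 <= m ->
  visits alpha E x (upath s j) -> visits alpha E x (dpath (s + m) l) ->
  multi_trans alpha E j [tuple of rev l] (hpow alpha s x) =
  \sum_(q <- upath s j) orbit_trans alpha E x q.1 q.2 -
  \sum_(q <- dpath (s + m) l) orbit_trans alpha E x q.1 q.2.
Proof.
move=> m0 xj xl.
have szl : (size l)%:Z = m by rewrite size_tuple; lia.
have upE : upath s (rev l) = rev (dpath (s + m) l) by rewrite -upath_rev szl addrK.
rewrite multi_transE.
- by rewrite !orbit_trans_shift add0r /vsum m0 /= upE big_rev.
- by apply/visits_shift; rewrite add0r /vpath m0.
- by apply/visits_shift => q; rewrite add0r /vpath m0 /= upE mem_rev; exact: xl.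
Qed.

Lemma visits_catP x p q :
  visits alpha E x (p ++ q) <-> visits alpha E x p /\ visits alpha E x q.
Proof.
split=> [H|[Hp Hq] u]; last by rewrite mem_cat => /orP[/Hp|/Hq].
by split=> u ui; apply: H; rewrite mem_cat ui ?orbT.
Qed.

Lemma is_class_visits2 a b g g' x i i' n n' :
  is_class a g x i n -> is_class b g' (hpow alpha n x) i' n' ->
  visits alpha E x (vpath n 0 i) /\ visits alpha E x (vpath n' n i').
Proof.
move=> /is_class_parts[_ ? _ _] /is_class_parts[_ xi' _ _]; split=> //.
by move/visits_shift: xi'; rewrite add0r.
Qed.

Section Cases.
Context (a b : Lam) (g g' : G) (x : X) (n n' : int).

Lemma mul_nonneg i i' : 0 <= n -> 0 <= n' ->
  is_class a g x i n -> is_class b g' (hpow alpha n x) i' n' ->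
  is_class (Lambda_mul a b) (g + g') x (i ++ i') (n + n').
Proof.
(* The two itineraries join end to end, so the correction term is 0. *)
move=> n0 n0' ai bi'; rewrite -[g]add0r.
have [si _ _ _] := is_class_parts ai; have [si' _ _ _] := is_class_parts bi'.
have nn' : 0 <= n + n' by lia.
have pE : upath 0 (i ++ i') = upath 0 i ++ upath n i'.
  by rewrite upath_cat add0r si; congr (_ ++ upath _ _); lia.
apply: (is_class_mul_sub ai bi'); first by rewrite size_cat; lia.
  by rewrite /vpath n0 n0' nn' pE.
by rewrite /vsum n0 n0' nn' pE big_cat add0r.
Qed.

Lemma mul_neg i i' : n < 0 -> n' < 0 ->
  is_class a g x i n -> is_class b g' (hpow alpha n x) i' n' ->
  is_class (Lambda_mul a b) (g + g') x (i ++ i') (n + n').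
Proof.
move=> n0 n0' ai bi'; rewrite -[g]add0r.
have [si _ _ _] := is_class_parts ai; have [si' _ _ _] := is_class_parts bi'.
have nn' : n + n' < 0 by lia.
have pE : dpath 0 (i ++ i') = dpath 0 i ++ dpath n i'.
  by rewrite dpath_cat add0r si; congr (_ ++ dpath _ _); lia.
apply: (is_class_mul_sub ai bi'); first by rewrite size_cat; lia.
  by rewrite /vpath (lt_geF n0) (lt_geF n0') (lt_geF nn') pE.
by rewrite /vsum (lt_geF n0) (lt_geF n0') (lt_geF nn') pE big_cat add0r opprD.
Qed.

Lemma mul_pos_opp (i i' : multi_index J n) : 0 < n -> n' = - n ->
  is_class a g x i n -> is_class b g' (hpow alpha n x) i' n' ->
  is_class (Lambda_mul a b)
    (multi_trans alpha E i [tuple of rev i'] x + g + g') x [::] 0.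
Proof.
move=> n0 n'E ai bi'; have n0' : n' < 0 by lia.
have [] := is_class_visits2 ai bi'; rewrite /vpath (ltW n0) (lt_geF n0') => vi vi'.
have nn' : n + n' = 0 by lia.
rewrite -nn'; apply: (is_class_mul_sub ai bi'); rewrite nn' //.
rewrite (multi_trans_rev (s := 0)) ?add0r//; last exact: ltW.
by rewrite /vsum lexx big_nil addr0 (ltW n0) (lt_geF n0').
Qed.

(** The forward half of the round trip is now [i'], starting at time [n]; hence the order of the
    indices and the evaluation point. *)
Lemma mul_neg_opp (i i' : multi_index J (- n)) : n < 0 -> n' = - n ->
  is_class a g x i n -> is_class b g' (hpow alpha n x) i' n' ->
  is_class (Lambda_mul a b)
    (multi_trans alpha E i' [tuple of rev i] (hpow alpha n x) + g + g')
    x [::] 0.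
Proof.
move=> n0 n'E ai bi'; have n0' : 0 <= n' by lia.
have [] := is_class_visits2 ai bi'; rewrite /vpath (lt_geF n0) n0' => vi vi'.
have nn' : n + n' = 0 by lia.
rewrite -nn'; apply: (is_class_mul_sub ai bi'); rewrite nn' //.
rewrite multi_trans_rev ?subrr//; last by lia.
by rewrite /vsum lexx big_nil addr0 n0' (lt_geF n0) addrC.
Qed.

(** [i1] descends from 0 to [n + n'], [i2] continues to [n], and [i'] climbs back over [i2]. *)
Lemma mul_neg_lt (i1 : multi_index J (- n - n')) (i2 i' : multi_index J n') :
  n < 0 -> 0 < n' -> n' < `|n| ->
  is_class a g x (i1 ++ i2) n -> is_class b g' (hpow alpha n x) i' n' ->
  is_class (Lambda_mul a b)
    (multi_trans alpha E i' [tuple of rev i2] (hpow alpha n x) + g + g')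
    x i1 (n + n').
Proof.
move=> n0 n0' nn' ai bi'; have {}n0' := ltW n0'.
have {}nn' : n + n' < 0 by lia.
have si1 : (size i1)%:Z = - (n + n') by rewrite size_tuple; lia.
have [] := is_class_visits2 ai bi'; rewrite /vpath (lt_geF n0) n0'.
rewrite dpath_cat si1 add0r opprK => /visits_catP[vi1 vi2] vi'.
apply: (is_class_mul_sub ai bi'); first by lia.
  by rewrite /vpath (lt_geF n0) (lt_geF nn') dpath_cat -catA => q; rewrite mem_cat => ->.
rewrite multi_trans_rev// /vsum n0' (lt_geF n0) (lt_geF nn') dpath_cat big_cat.
rewrite si1 add0r opprK /= opprD.
by rewrite [LHS]addrC addrA addrAC.
Qed.

(** [i] descends from 0 to [n], [i1'] climbs back to 0, and [i2'] remains. *)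
Lemma mul_neg_gt (i i1' : multi_index J (- n)) (i2' : multi_index J (n + n')) :
  n < 0 -> 0 < n' -> `|n| < n' ->
  is_class a g x i n -> is_class b g' (hpow alpha n x) (i1' ++ i2') n' ->
  is_class (Lambda_mul a b)
    (multi_trans alpha E i1' [tuple of rev i] (hpow alpha n x) + g + g')
    x i2' (n + n').
Proof.
move=> n0 n0' nn' ai bi'; have {}n0' := ltW n0'.
have {}nn' : 0 <= n + n' by lia.
have si1 : (size i1')%:Z = - n by rewrite size_tuple; lia.
have [] := is_class_visits2 ai bi'; rewrite /vpath (lt_geF n0) n0'.
rewrite upath_cat si1 subrr => vi /visits_catP[vi1 vi2].
apply: (is_class_mul_sub ai bi'); first by rewrite size_tuple.
  rewrite /vpath nn' n0' upath_cat si1 subrr catA => q.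
  by rewrite [in X in _ -> X]mem_cat orbC => ->.
rewrite multi_trans_rev ?subrr//; last by lia.
rewrite /vsum n0' nn' (lt_geF n0) upath_cat big_cat si1 subrr /=.
by rewrite addrAC [LHS]addrC.
Qed.

(** [i] climbs from 0 to [n], [i1'] returns to 0, and [i2'] continues into negative times. *)
Lemma mul_pos_lt (i i1' : multi_index J n) (i2' : multi_index J (- n' - n)) :
  0 < n -> n' < 0 -> n < `|n'| ->
  is_class a g x i n -> is_class b g' (hpow alpha n x) (i1' ++ i2') n' ->
  is_class (Lambda_mul a b)
    (multi_trans alpha E i [tuple of rev i1'] x + g + g') x i2' (n + n').
Proof.
move=> n0 n0' nn' ai bi'; have {}n0 := ltW n0.
have {}nn' : n + n' < 0 by lia.
have si1 : (size i1')%:Z = n by rewrite size_tuple; lia.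
have [] := is_class_visits2 ai bi'; rewrite /vpath (lt_geF n0') n0.
rewrite dpath_cat si1 subrr => vi /visits_catP[vi1 vi2].
apply: (is_class_mul_sub ai bi'); first by rewrite size_tuple; lia.
  rewrite /vpath (lt_geF n0') (lt_geF nn') dpath_cat si1 subrr catA => q.
  by rewrite [in X in _ -> X]mem_cat orbC => ->.
rewrite (multi_trans_rev (s := 0)) ?add0r//.
by rewrite /vsum n0 (lt_geF n0') (lt_geF nn') dpath_cat big_cat si1 subrr /= opprD addrA.
Qed.

(** The retraced segment runs from [n + n'] to [n]: up along [i2], down along [i']. What remains is
    [i1]. *)
Lemma mul_pos_gt (i1 : multi_index J (n + n')) (i2 i' : multi_index J (- n')) :
  0 < n -> n' < 0 -> `|n'| < n ->
  is_class a g x (i1 ++ i2) n -> is_class b g' (hpow alpha n x) i' n' ->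
  is_class (Lambda_mul a b)
    (multi_trans alpha E i2 [tuple of rev i'] (hpow alpha (n + n') x) + g + g')
    x i1 (n + n').
Proof.
move=> n0 n0' nn' ai bi'; have {}n0 := ltW n0.
have {}nn' : 0 <= n + n' by lia.
have si1 : (size i1)%:Z = n + n' by rewrite size_tuple; lia.
have [] := is_class_visits2 ai bi'; rewrite /vpath (lt_geF n0') n0.
rewrite upath_cat si1 add0r => /visits_catP[vi1 vi2] vi'.
apply: (is_class_mul_sub ai bi'); first by rewrite size_tuple.
  by rewrite /vpath nn' n0 upath_cat -catA => q; rewrite mem_cat => ->.
rewrite multi_trans_rev ?addrK//; last by lia.
rewrite /vsum n0 nn' (lt_geF n0') upath_cat big_cat si1 add0r /=.
by rewrite [LHS]addrC addrA.
Qed.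

End Cases.
End Products.

(** * Topology *)

Lemma near_seq (T : Type) (I : eqType) (F : set_system T) {FF : Filter F}
    (s : seq I) (P : I -> T -> Prop) :
  {in s, forall q, \forall x \near F, P q x} ->
  \forall x \near F, {in s, forall q, P q x}.
Proof.
elim: s => [|q s IH] H; first by apply: nearW => x q.
have Hq := H q (mem_head _ _).
have Hs : \forall x \near F, {in s, forall q, P q x}.
  by apply: IH => r rs; apply: H; rewrite inE rs orbT.
apply: filterS2 Hq Hs => x Pq Ps r; rewrite inE => /predU1P[->//|]; exact: Ps.
Qed.

Lemma cvg_add (T : Type) (G : topologicalZmodType) (F : set_system T)
    {FF : Filter F} (f g : T -> G) (a b : G) :
  f x @[x --> F] --> a -> g x @[x --> F] --> b -> f x + g x @[x --> F] --> a + b.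
Proof. by apply: continuous2_cvg; exact: (@add_continuous G (a, b)). Qed.

Lemma cvg_opp (T : Type) (G : topologicalZmodType) (F : set_system T)
    {FF : Filter F} (f : T -> G) (a : G) :
  f x @[x --> F] --> a -> - f x @[x --> F] --> - a.
Proof. by apply: continuous_cvg; exact: opp_continuous. Qed.

Lemma cvg_sum_seq (T : Type) (I : eqType) (G : topologicalZmodType)
    (F : set_system T) {FF : Filter F} (s : seq I) (f : I -> T -> G) (l : I -> G) :
  {in s, forall q, f q x @[x --> F] --> l q} ->
  \sum_(q <- s) f q x @[x --> F] --> \sum_(q <- s) l q.
Proof.
elim: s => [|q s IH] H.
  by rewrite big_nil; under eq_cvg do rewrite big_nil; exact: cvg_cst.
rewrite big_cons; under eq_cvg do rewrite big_cons.
apply: cvg_add; first exact: H (mem_head _ _).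
by apply: IH => r rs; apply: H; rewrite inE rs orbT.
Qed.

(** * Charts of a glued space: continuity and openness *)

Section GluedTopology.
Local Open Scope quotient_scope.
Context (X : topologicalType) (G : topologicalZmodType) (K : choiceType).
Context (D : gluing X G K) (dom_open : forall i, open (dom D i)).
Context (trans_cvg : forall i j x, dom D i x -> dom D j x ->
  trans D i j y @[y --> x] --> trans D i j x).

(** Continuity of a chart, phrased with neighbourhoods in [G * X] instead of the subtype
    [dom D i]. *)
Lemma glue_class_near i g (u : dom D i) (A : set (glued D)) :
  nbhs (glue_class g u) A ->
  \forall p \near (g, \val u), forall v : dom D i, \val v = p.2 ->
    A (glue_class p.1 v).
Proof.
move=> /pi_continuous; rewrite /nbhs /= => -[[V W] /= [Vg Wu] VW].
case: Wu => _ [[U oU <-] /= Uu UW].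
exists (V, U) => /=; first by split => //; exact: open_nbhs_nbhs.
move=> [h y] /= [Vh Uy] v vy; apply: (VW (h, v)); split => //=.
by apply: UW; move: Uy; rewrite -vy.
Qed.

(** Charts are open maps: seen from a piece [j], the image of an open box consists of the points
    whose transition into chart [i] lands in the box, an open condition. *)
Lemma glue_chart_near i g (u : dom D i) (V : set G) (W : set X) :
  nbhs g V -> nbhs (\val u) W ->
  \forall c \near glue_class g u,
    exists h (v : dom D i), [/\ V h, W (\val v) & c = glue_class h v].
Proof.
rewrite [nbhs g]nbhsE [nbhs (\val u)]nbhsE => -[V' [oV V'g] VV'] [W' [oW W'u] WW'].
pose O := [set c : glued D | exists h (v : dom D i),
    [/\ V' h, W' (\val v) & c = glue_class h v]].
apply: (@filterS _ (nbhs (glue_class g u)) _ O); last apply: open_nbhs_nbhs.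
  by move=> c [h [v [/VV' ? /WW' ? ->]]]; exists h, v.
split; last by exists g, u.
(* Openness in the quotient is tested on the preimage in the disjoint union, piece by piece. *)
apply/sigT_openP => j; rewrite openE => -[h y] /= [h0 [v [V'h0 W'v]]].
move=> /glue_classE[yv h0E].
have jy : dom D j (\val y) := set_valP y.
have iy : dom D i (\val y) by rewrite yv; exact: set_valP.
have near_y : \forall z \near \val y, dom D i z /\ W' z.
  by near=> z; split; near: z; apply: open_nbhs_nbhs; rewrite // yv.
have val_cvg : \val z @[z --> y] --> \val y.
  exact: (@initial_continuous _ _ set_val).
have V'y : \forall p \near (h, y), V' (trans D j i (\val p.2) + p.1).
  have cvg_tr : trans D j i (\val p.2) + p.1 @[p --> (h, y)] -->
      trans D j i (\val y) + h.
    apply: cvg_add; last exact: cvg_fst.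
    have c1 : (\val p.2 : X) @[p --> (h, y)] --> \val y.
      apply: (cvg_comp _ _ _ val_cvg); exact: cvg_snd.
    exact: (cvg_comp _ _ c1 (trans_cvg jy iy)).
  by apply: cvg_tr; apply: open_nbhs_nbhs; rewrite -h0E.
have near_p : \forall p \near (h, y), dom D i (\val p.2) /\ W' (\val p.2).
  exact: (cvg_comp _ _ cvg_snd val_cvg) near_y.
apply: filterS2 near_p V'y => -[h1 y1] /= [iy1 W'y1] V'p.
have iy1' : \val y1 \in dom D i by exact/mem_set.
exists (trans D j i (\val y1) + h1), (SigSub iy1'); split => //.
by apply/glue_classE.
Unshelve. all: by end_near.
Qed.

End GluedTopology.

(** * Continuity of the inverse and of the product *)

Section LambdaTopology.
Context (X : topologicalType) (G : topologicalZmodType) (J : finType).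
Context (alpha : self_homeo X) (E : bundle_data X G J).

Local Notation Lam := (Lambda alpha E).
Implicit Types (a b : Lam) (x y : X) (n : int) (g h : G) (i : seq J).

Lemma hpow_continuous n : continuous (hpow alpha n).
Proof.
have iter_cont (f : X -> X) m : continuous f -> continuous (iter m f).
  move=> fc; elim: m => [|m IH] x; first exact: cvg_id.
  exact: (cvg_comp _ _ (IH x) (fc _)).
case: n => m; apply: iter_cont; [exact: sh_continuous|exact: sh_inv_continuous].
Qed.

Lemma bundle_trans_cvg (i j : J) x : dom E i x -> dom E j x ->
  trans E i j y @[y --> x] --> trans E i j x.
Proof.
move=> ix jx.
have /subspace_continuousP /(_ x (conj ix jx)) := @trans_continuous _ _ _ E i j.
(* The overlap is open, so continuity within it is continuity at its points. *)
rewrite within_interior //.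
have /interior_id -> : open (dom E i `&` dom E j) by apply: openI; exact: cover_open.
by split.
Qed.

Lemma visits_near x s : visits alpha E x s -> \forall y \near x, visits alpha E y s.
Proof.
move=> xs; apply: near_seq => q /xs xq.
apply: (@hpow_continuous q.2 x); apply: open_nbhs_nbhs; split=> //; exact: cover_open.
Qed.

Lemma multi_dom_open n (i : multi_index J n) : open (dom (Lambda_gluing alpha E n) i).
Proof.
rewrite openE => x /multi_domE /visits_near.
by apply: filterS => y /multi_domE.
Qed.

Lemma multi_trans_cvg n (i j : multi_index J n) x :
  dom (Lambda_gluing alpha E n) i x -> dom (Lambda_gluing alpha E n) j x ->
  trans (Lambda_gluing alpha E n) i j y @[y --> x] -->
  trans (Lambda_gluing alpha E n) i j x.
Proof.
move=> ix jx; rewrite /= /multi_trans.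
have := fun k => multi_domP k ix; have := fun k => multi_domP k jx.
case: ifP => _ Hj Hi; apply: cvg_sum_seq => k _; last apply: cvg_opp.
  exact: (cvg_comp _ _ (@hpow_continuous _ x) (bundle_trans_cvg (Hi k) (Hj k))).
exact: (cvg_comp _ _ (@hpow_continuous _ x) (bundle_trans_cvg (Hi k) (Hj k))).
Qed.

Lemma is_class_near a g x i n (A : set Lam) : is_class a g x i n -> nbhs a A ->
  \forall p \near (g, x), forall b, is_class b p.1 p.2 i n -> A b.
Proof.
move=> [t [u [<- <- ->]]] aA.
have /glue_class_near : nbhs (glue_class g u) (existT (Lambda_ alpha E) n @^-1` A).
  exact: aA.
apply: filterS => p H b [t' [v [/val_inj tt vp ->]]].
by move: v vp; rewrite tt => v /H.
Qed.

(** Openness of charts lets the continuity proofs replace nearby elements by coordinates in one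
    fixed chart. *)
Lemma chart_near a g x i n (V : set G) (W : set X) :
  is_class a g x i n -> nbhs g V -> nbhs x W ->
  \forall b \near a, exists h y, [/\ V h, W y & is_class b h y i n].
Proof.
move=> [t [u [<- <- ->]]] Vg Wu.
have H := glue_chart_near (@multi_dom_open n) (@multi_trans_cvg n) Vg Wu.
have := existT_nbhs (X := Lambda_ alpha E) _ _ _ H.
apply: filterS => _ [_ [h [v [Vh Wv ->]] <-]].
by exists h, (\val v); split=> //; exists t, v.
Qed.

Lemma pt_continuous : continuous (@pt _ _ _ alpha E).
Proof.
move=> a W Wa; have [g [i ai]] := ex_class a.
apply: filterS (chart_near ai (@filterT _ (nbhs g) _) Wa) => b [h [y [_ Wy bi]]].
have [_ _ _ bx] := is_class_parts bi; by rewrite -bx in Wy.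
Qed.

Lemma Lambda_unit_continuous : continuous (Lambda_unit alpha E).
Proof.
move=> x A Ax.
have [[V W] /= [V0 Wx] VW] := is_class_near (is_class_unit alpha E x) Ax.
apply: filterS Wx => y Wy; apply: (VW (0, y)); last exact: is_class_unit.
by split=> //=; exact: nbhs_singleton.
Qed.

(** Each sum alone may jump with the reference charts; the combination follows a closed itinerary
    through 0, [n], [n + n'] and back, which does not see that choice. *)
Lemma orbit_trans_sum_cvg x n n' i i' k :
  size i = `|n|%N -> size i' = `|n'|%N -> size k = absz (n + n') ->
  visits alpha E x (vpath n 0 i) -> visits alpha E x (vpath n' n i') ->
  visits alpha E x (vpath (n + n') 0 k) ->
  let F y := vsum (orbit_trans alpha E y) n 0 i + vsum (orbit_trans alpha E y) n' n i'
     - vsum (orbit_trans alpha E y) (n + n') 0 k in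
  F y @[y --> x] --> F x.
Proof.
move=> si si' sk xi xi' xk F.
pose psi p := ref_chart E (hpow alpha p x).
pose e y j p := trans E j (psi p) (hpow alpha p y).
pose F' y := vsum (e y) n 0 i + vsum (e y) n' n i' - vsum (e y) (n + n') 0 k.
pose L := vpath n 0 i ++ vpath n' n i' ++ vpath (n + n') 0 k.
have xL : visits alpha E x L by apply/visits_catP; split=> //; apply/visits_catP.
have xpsi : visits alpha E x [seq (psi q.2, q.2) | q <- L].
  by move=> _ /mapP[q _ ->]; exact: ref_chartP.
have FF' : \forall y \near x, F' y = F y.
  apply: filterS2 (visits_near xL) (visits_near xpsi) => y yL ypsi.
  pose f p := trans E (psi p) (ref_chart E (hpow alpha p y)) (hpow alpha p y).
  have [A AS] := antidifference f.
  have E1 m s l : size l = `|m|%N -> {subset vpath m s l <= L} ->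
      vsum (orbit_trans alpha E y) m s l = vsum (e y) m s l + (A (s + m) - A s).
    move=> sl lL; rewrite -(vsum_telescope s AS sl) -vsumD; apply: eq_vsum => q /lL qL.
    rewrite /orbit_trans /e /f (trans_cocycle (yL _ qL) _ (ref_chartP _ _))//.
    exact: ypsi (map_f (fun q => (psi q.2, q.2)) qL).
  rewrite /F !E1//; try by move=> q; rewrite !mem_cat => ->; rewrite ?orbT.
  (* The boundary terms of the two legs add up to that of the direct itinerary. *)
  have -> : A (0 + (n + n')) - A 0 = A (0 + n) - A 0 + (A (n + n') - A n).
    by rewrite !add0r [RHS]addrC addrA subrK.
  by rewrite [X in _ = X - _]addrACA opprD [RHS]addrACA subrr addr0.
have F'F : F' x = F x by exact: nbhs_singleton FF'.
rewrite -F'F; apply: cvg_trans (near_eq_cvg FF') _.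
have e_cvg m s l : visits alpha E x (vpath m s l) ->
    vsum (e y) m s l @[y --> x] --> vsum (e x) m s l.
  move=> xl; rewrite vsumE; under eq_cvg do rewrite vsumE.
  apply: cvg_sum_seq => q /xl xq.
  have H : e y q.1 q.2 @[y --> x] --> e x q.1 q.2.
    exact: (cvg_comp _ _ (@hpow_continuous _ x) (bundle_trans_cvg xq (ref_chartP _ _))).
  by case: ifP => _ //; exact: cvg_opp.
by apply: cvg_add; [apply: cvg_add|apply: cvg_opp]; exact: e_cvg.
Qed.

Lemma Lambda_inv_continuous : continuous (@Lambda_inv _ _ _ alpha E).
Proof.
move=> a A Aa; have [g [i ai]] := ex_class a.
have [[V W] /= [Vg Wx] VW] := is_class_near (is_class_inv ai) Aa.
have := chart_near ai (@opp_continuous G g V Vg) (@hpow_continuous _ _ _ Wx).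
apply: filterS => b [h [y [Vh Wy /is_class_inv bi]]].
exact: (VW (- h, _)) bi.
Qed.

Lemma Lambda_mul_continuous : {within [set p : Lam * Lam | Lambda_composable p.1 p.2],
  continuous (fun p : Lam * Lam => Lambda_mul p.1 p.2)}.
Proof.
apply/subspace_continuousP => -[a b] /= ab A Aab.
have [g [i ai]] := ex_class a; have [g' [i' bi']] := ex_class b.
have [c [k ck]] := ex_class (Lambda_mul a b).
have [n1 x1 h1] := Lambda_mulE a b.
rewrite x1 n1 in ck; rewrite -ab in bi'.
set n := deg a in ai bi' ck; set n' := deg b in bi' ck; set x := pt a in ai bi' ck.
have [si xi _ _] := is_class_parts ai; have [si' _ _ _] := is_class_parts bi'.
have [sk xk _ _] := is_class_parts ck.
have [_ xi'] := is_class_visits2 ai bi'.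
(* [F y] is the value of [c] that [is_class_mul] requires in the charts [i], [i'], [k]. *)
pose F y := vsum (orbit_trans alpha E y) n 0 i + vsum (orbit_trans alpha E y) n' n i'
     - vsum (orbit_trans alpha E y) (n + n') 0 k.
have Fx : F y @[y --> x] --> F x by exact: orbit_trans_sum_cvg.
have mulF : forall a b g g' y, visits alpha E y (vpath (n + n') 0 k) ->
    is_class a g y i n -> is_class b g' (hpow alpha n y) i' n' ->
    is_class (Lambda_mul a b) (F y + g + g') y k (n + n').
  move=> a1 b1 g1 g1' y yk a1i b1i; apply: is_class_mul a1i b1i sk yk _.
  by rewrite subrK.
have ck' := mulF _ _ _ _ _ xk ai bi'.
have near_p : \forall q \near ((g, g'), x), forall d,
    is_class d (F q.2 + q.1.1 + q.1.2) q.2 k (n + n') -> A d.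
  have cvg_q : (F q.2 + q.1.1 + q.1.2, q.2) @[q --> ((g, g'), x)] --> (F x + g + g', x).
    apply: cvg_pair; last exact: cvg_snd.
    apply: cvg_add; [apply: cvg_add|].
    - exact: (cvg_comp _ _ cvg_snd Fx).
    - exact: (cvg_comp _ _ cvg_fst cvg_fst).
    - exact: (cvg_comp _ _ cvg_fst cvg_snd).
  exact: cvg_q (is_class_near ck' Aab).
have [[VV' W] /= [[[V V'] /= [Vg V'g'] VV] Wx] VW] := near_p.
(* [W] is shrunk so that the chart [k] stays defined at the base point of the product. *)
have Wx' : nbhs x (W `&` [set y | visits alpha E y (vpath (n + n') 0 k)]).
  by apply: filterI => //; exact: visits_near xk.
(* The base point of the second factor is left free, since composability ties it to that of the
   first. *)
exists ([set a1 | exists h y,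
    [/\ V h, (W `&` [set y | visits alpha E y (vpath (n + n') 0 k)]) y &
      is_class a1 h y i n]],
  [set b1 | exists h y, [/\ V' h, [set: X] y & is_class b1 h y i' n']]) => /=.
  by split; [exact: (chart_near ai Vg Wx')|exact: (chart_near bi' V'g' filterT)].
move=> [a1 b1] /= [[h [y [Vh [Wy yk] a1i]]] [h' [y' [V'h' _ b1i]]]] ab1.
have [_ _ n2 x2] := is_class_parts a1i; have [_ _ n3 x3] := is_class_parts b1i.
move: ab1; rewrite /Lambda_composable n2 x2 x3 => y'E; rewrite -{}y'E in b1i.
apply: (VW ((h, h'), y)); last exact: mulF.
by split => //; exact: (VV (h, h')).
Qed.

End LambdaTopology.

(** * Homeomorphism of the unit spaces *)

Section UnitSpace.
Context (X : topologicalType) (G : topologicalZmodType) (J : finType).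
Context (alpha : self_homeo X) (E : bundle_data X G J).

Lemma unit_space_homeo :
  exists2 f : Gamma_unit_space X -> Lambda_unit_space alpha E,
    is_homeomorphism f & forall u, \val (f u) = Lambda_unit alpha E (\val u).1.
Proof.
have fP x : Lambda_unit alpha E x \in Lambda_unit_space alpha E.
  by apply/mem_set; exists x.
have gP x : ((x, 0) : Gamma X) \in Gamma_unit_space X by exact/mem_set.
pose f (u : Gamma_unit_space X) : Lambda_unit_space alpha E := SigSub (fP (\val u).1).
(* The inverse reads off the base point, with constant time 0. *)
pose g (v : Lambda_unit_space alpha E) : Gamma_unit_space X := SigSub (gP (pt (\val v))).
exists f => //; split.
  apply: continuous_comp_initial => u.
  have val_fst : (\val v).1 @[v --> u] --> (\val u).1.
    exact: (cvg_comp _ _ (@initial_continuous _ _ set_val u) cvg_fst).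
  exact: (cvg_comp _ _ val_fst (@Lambda_unit_continuous _ _ _ alpha E _)).
exists g; split.
- apply: continuous_comp_initial => v.
  have val_pt : pt (\val w) @[w --> v] --> pt (\val v).
    exact: (cvg_comp _ _ (@initial_continuous _ _ set_val v)
      (@pt_continuous _ _ _ alpha E _)).
  exact: (cvg_pair val_pt (@cvg_cst (discrete_topology int) 0 _ (nbhs v) _)).
- case=> -[x n] xn; apply: val_inj => /=; have [_ -> _] := Lambda_unitE alpha E x.
  by have /= <- := set_mem xn.
- case=> a aP; apply: val_inj => /=; have [x _ <-] := set_mem aP.
  by have [_ -> _] := Lambda_unitE alpha E x.
Qed.

End UnitSpace.

(** * Assembly of the groupoid, its units and the product formulas *)

Theorem theorem5p1 (R : realType) (X : metricType R) (G : topologicalZmodType)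
    (J : finType) (alpha : self_homeo X) (E : bundle_data X G J)
    (X_compact : compact [set: X]) (G_compact : compact [set: G]) :
  exists S : groupoid (Lambda alpha E),
    topological_groupoid S /\
    (forall a, grange S a = Lambda_range a) /\
    (forall a, gsource S a = Lambda_source a) /\
    (forall a b, composable S a b <-> Lambda_source a = Lambda_range b) /\
    (* unit space *)
    gunits S = Lambda_unit_space alpha E /\
    gunits (Gamma_groupoid alpha) = Gamma_unit_space X /\
    (exists2 f : Gamma_unit_space X -> Lambda_unit_space alpha E,
       is_homeomorphism f &
       forall u, \val (f u) = Lambda_unit alpha E (\val u).1) /\
    (forall (a b : Lambda alpha E) (g g' : G) (x x' : X) (i i' : seq J)
            (n n' : int),
       is_class a g x i n -> is_class b g' x' i' n' ->
       (Lambda_source a = Lambda_range b <-> hpow alpha n x = x')) /\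
    (* products *)
    (forall (a b : Lambda alpha E) (g g' : G) (x x' : X) (n n' : int),
       Lambda_source a = Lambda_range b ->
       (* (a) *)
       (0 <= n -> 0 <= n' ->
        forall (i : multi_index J n) (i' : multi_index J n'),
          is_class a g x i n -> is_class b g' x' i' n' ->
          is_class (gmul S a b) (g + g') x (i ++ i') (n + n')) /\
       (* (b) *)
       (n < 0 -> n' < 0 ->
        forall (i : multi_index J n) (i' : multi_index J n'),
          is_class a g x i n -> is_class b g' (hpow alpha n x) i' n' ->
          is_class (gmul S a b) (g + g') x (i ++ i') (n + n')) /\
       (* (c) *)
       (0 < n -> n' = - n ->
        forall i i' : multi_index J n,
          is_class a g x i n -> is_class b g' (hpow alpha n x) i' n' ->
          is_class (gmul S a b)
            (multi_trans alpha E i [tuple of rev i'] x + g + g') x [::] 0) /\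
       (* (d) *)
       (n < 0 -> n' = - n ->
        forall i i' : multi_index J (- n),
          is_class a g x i n -> is_class b g' (hpow alpha n x) i' n' ->
          is_class (gmul S a b)
            (multi_trans alpha E i' [tuple of rev i] (hpow alpha n x) + g + g')
            x [::] 0) /\
       (* (e) *)
       (n < 0 -> 0 < n' -> n' < `|n| ->
        forall (i1 : multi_index J (- n - n')) (i2 i' : multi_index J n'),
          is_class a g x (i1 ++ i2) n ->
          is_class b g' (hpow alpha n x) i' n' ->
          is_class (gmul S a b)
            (multi_trans alpha E i' [tuple of rev i2] (hpow alpha n x) + g + g')
            x i1 (n + n')) /\
       (* (f) *)
       (n < 0 -> 0 < n' -> `|n| < n' ->
        forall (i i1' : multi_index J (- n)) (i2' : multi_index J (n + n')),
          is_class a g x i n ->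
          is_class b g' (hpow alpha n x) (i1' ++ i2') n' ->
          is_class (gmul S a b)
            (multi_trans alpha E i1' [tuple of rev i] (hpow alpha n x) + g + g')
            x i2' (n + n')) /\
       (* (g) *)
       (0 < n -> n' < 0 -> n < `|n'| ->
        forall (i i1' : multi_index J n) (i2' : multi_index J (- n' - n)),
          is_class a g x i n ->
          is_class b g' (hpow alpha n x) (i1' ++ i2') n' ->
          is_class (gmul S a b)
            (multi_trans alpha E i [tuple of rev i1'] x + g + g')
            x i2' (n + n')) /\
       (* (h) *)
       (0 < n -> n' < 0 -> `|n'| < n ->
        forall (i1 : multi_index J (n + n')) (i2 i' : multi_index J (- n')),
          is_class a g x (i1 ++ i2) n ->
          is_class b g' (hpow alpha n x) i' n' ->
          is_class (gmul S a b)
            (multi_trans alpha E i2 [tuple of rev i'] (hpow alpha (n + n') x)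
               + g + g')
            x i1 (n + n'))) /\
    (* inverses *)
    (forall (a : Lambda alpha E) (g : G) (x : X) (n : int) (i : multi_index J n),
       is_class a g x i n ->
       is_class (ginv S a) (- g) (hpow alpha n x) (rev i) (- n)).
Proof.
exists (Lambda_groupoid alpha E); split.
  by split; [exact: Lambda_inv_continuous|exact: Lambda_mul_continuous].
(* Units agree exactly when their base points do. *)
have sourceE (a b : Lambda alpha E) :
    Lambda_source a = Lambda_range b <-> Lambda_composable a b.
  exact: Lambda_unit_eq.
split; first exact: Lambda_grange.
split; first exact: Lambda_gsource.
split; first by move=> a b; split=> /sourceE.
split; first exact: Lambda_gunits.
split; first exact: Gamma_unitsE.
split; first exact: unit_space_homeo.
split.
  move=> a b g g' x x' i i' n n' ai bi'; rewrite sourceE /Lambda_composable.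
  have [_ _ -> ->] := is_class_parts ai; by have [_ _ _ ->] := is_class_parts bi'.
split; last by move=> a g x n i; exact: is_class_inv.
move=> a b g g' x x' n n' /sourceE ab.
split.
  move=> n0 n0' i i' ai bi'; apply: mul_nonneg => //.
  (* Case (a) is stated over [x']; composability brings it to the form of the other cases. *)
  suff -> : hpow alpha n x = x' by [].
  move: ab; rewrite /Lambda_composable; have [_ _ -> ->] := is_class_parts ai.
  by have [_ _ _ ->] := is_class_parts bi'.
split; first by move=> n0 n0' i i'; exact: mul_neg.
split; first by move=> n0 n'E i i'; exact: mul_pos_opp.
split; first by move=> n0 n'E i i'; exact: mul_neg_opp.
split; first by move=> n0 n0' nn' i1 i2 i'; exact: mul_neg_lt.
split; first by move=> n0 n0' nn' i i1' i2'; exact: mul_neg_gt.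
split; first by move=> n0 n0' nn' i i1' i2'; exact: mul_pos_lt.
by move=> n0 n0' nn' i1 i2 i'; exact: mul_pos_gt.
Qed.
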